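(* Let $G$ be a finite group, let $\alpha:G\times G\to G$ be the commutator map $\alpha(x,y)=x^{-1}y^{-1}xy$, and set $\epsilon(G)=(\zeta^G(2)-1)^{1/4}$. (i) For all $Y\subseteq G$, $$\left|\frac{|\alpha^{-1}(Y)|}{|G|^2}-\frac{|Y|}{|G|}\right|\le 3\epsilon(G).$$ (ii) If $X\subseteq G\times G$ then $$\frac{|\alpha(X)|}{|G|}\ge\frac{|X|}{|G|^2}-3\epsilon(G).$$
   Context: For a finite group $G$, $\mathrm{Irr}(G)$ denotes the set of complex irreducible characters of $G$, and $\zeta^G(s)=\sum_{\chi\in\mathrm{Irr}(G)}\chi(1)^{-s}$ for real $s$. *)

(* Defs.v *)
From HB Require Import structures.
From mathcomp Require Import all_boot all_order all_algebra all_fingroup all_field all_character.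
From mathcomp Require Import reals exp.

Set Implicit Arguments.
Unset Strict Implicit.
Unset Printing Implicit Defensive.

Import GRing.Theory Num.Theory.
Local Open Scope ring_scope.

(* MathComp characters take their values in algC, so the degree chi(1) is read
   back as a natural number before it is raised to a real power. *)
Definition irr_deg (gT : finGroupType) (G : {group gT}) (i : Iirr G) : nat :=
  Num.truncn ('chi_i 1%g).

Lemma irr_degE (gT : finGroupType) (G : {group gT}) (i : Iirr G) :
  (irr_deg i)%:R = 'chi_i 1%g.
Proof. exact/eqP/(Cnat_irr1 i). Qed.

Definition zeta (R : realType) (gT : finGroupType) (G : {group gT}) (s : R) : R :=
  \sum_(i : Iirr G) (irr_deg i)%:R `^ (- s).

Definition epsilon (R : realType) (gT : finGroupType) (G : {group gT}) : R :=
  (zeta G 2 - 1) `^ 4^-1.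

(* [~ x, y] is x^-1 * (y^-1 * (x * y)). *)
Definition comm_map (gT : finGroupType) (u : gT * gT) : gT := [~ u.1, u.2]%g.

(* Main.v *)
(* Let N(g) be the number of pairs (x, y) with [x, y] = g.  By Schur's lemma N
   is the class function whose coordinate on chi is |G| / chi(1) (Frobenius), so
   Parseval gives sum_g (N(g) - |G|)^2 = |G|^3 (zeta(2) - 1) = |G|^3 epsilon^4.
   Cauchy-Schwarz over Y then bounds the square of the deviation D in (i) by
   epsilon^4; since |D| <= 1, |D|^4 <= |D|^2 and hence |D| <= epsilon.  Part (ii)
   is (i) applied to Y = alpha(X), whose preimage contains X. *)

Require Import Defs.
From mathcomp Require Import all_boot all_order all_algebra all_fingroup all_field all_character.
From mathcomp Require Import reals exp ring lra.

Set Implicit Arguments.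
Unset Strict Implicit.
Unset Printing Implicit Defensive.

Import Order.TTheory GRing.Theory Num.Theory.
Local Open Scope ring_scope.

(** The sum [A] of the matrices [rG (y ^ z)] commutes with the irreducible representation [rG], so
    it is a scalar [a] by Schur. The trace of [A] determines [a], and the trace of [rG x *m A] is
    the sum sought. *)
Lemma sum_irr_mul_conj (gT : finGroupType) (G : {group gT}) (i : Iirr G) :
  {in G &, forall x y,
     \sum_(z in G) 'chi_i (x * y ^ z)%g
       = #|G|%:R * 'chi_i x * 'chi_i y / 'chi_i 1%g}.
Proof.
move=> x y Gx Gy; pose rG := 'Chi_i; pose A := \sum_(z in G) rG (y ^ z)%g.
have chiE z : z \in G -> 'chi_i z = \tr (rG z).
  by move=> Gz; rewrite -irrRepr cfunE Gz mulr1n.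
have /is_scalar_mxP[a defA] : is_scalar_mx A.
  apply: (@mx_abs_irr_cent_scalar _ _ _ _ rG); first exact/groupC/socle_irr.
  apply/centgmxP=> w Gw; rewrite mulmx_suml mulmx_sumr.
  (* The translation [z -> z * w] permutes the summands of [A], which yields commutation with
     [rG w]. *)
  rewrite [RHS](reindex_inj (mulIg w)) /=; apply: eq_big => [z | z Gz].
    by rewrite groupMr.
  by rewrite -!repr_mxM ?groupJ ?groupM // conjgM -conjgC.
have trA : 'chi_i 1%g * a = #|G|%:R * 'chi_i y.
  rewrite chiE // repr_mx1 mxtrace_scalar [LHS]mulr_natl -[LHS]mxtrace_scalar -defA.
  rewrite raddf_sum /= -sumr_const mulr_suml; apply: eq_bigr => z Gz.
  by rewrite mul1r -chiE ?groupJ // cfunJ.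
transitivity (a * 'chi_i x).
  rewrite [in RHS]chiE // -mxtraceZ -mul_mx_scalar -defA mulmx_sumr raddf_sum.
  apply: eq_bigr => z Gz; have Gyz : (y ^ z)%g \in G by rewrite groupJ.
  by rewrite /= (chiE _ (groupM Gx Gyz)) repr_mxM.
rewrite [X in X / _]mulrAC -trA -[_ * a * _]mulrA [RHS]mulrAC.
by rewrite divff ?irr1_neq0 // mul1r.
Qed.

Definition comm_count (gT : finGroupType) (G : {set gT}) (g : gT) : nat :=
  #|[set u in setX G G | comm_map u == g]|.

Lemma sum_comm_count (gT : finGroupType) (G : {group gT}) (F : pzSemiRingType)
    (Y : {set gT}) (f : gT -> F) :
  \sum_(g in Y) (comm_count G g)%:R * f g
    = \sum_(u in setX G G | comm_map u \in Y) f (comm_map u).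
Proof.
rewrite (partition_big (@comm_map gT) (mem Y)) /= => [|u /andP[]//].
apply: eq_bigr => g Yg.
rewrite (eq_bigr (fun=> f g)) => [|u /andP[_ /eqP->] //].
rewrite sumr_const mulr_natl; congr (_ *+ _); apply: eq_card => u.
rewrite inE [RHS]unfold_in.
by case: eqP => [->|_]; rewrite ?Yg ?andbT ?andbF.
Qed.

(** Conjugating both entries of a pair by [z] maps the fibre over [g] bijectively onto the fibre
    over [g ^ z]. The generated group [<<G>>] is the form that the constructor [Cfun] expects. *)
Lemma comm_count_class_fun (gT : finGroupType) (G : {group gT}) :
  is_class_fun <<G>>%g [ffun g => (comm_count G g)%:R].
Proof.
rewrite genGid; apply: intro_class_fun => [g z Gg Gz | g notGg].
  congr _%:R; pose J (u : gT * gT) := (u.1 ^ z, u.2 ^ z)%g.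
  have injJ : injective J by move=> [a b] [c d] [/conjg_inj-> /conjg_inj->].
  rewrite /comm_count -[RHS](card_imset _ injJ); apply: eq_card => u.
  apply/idP/imsetP => [|[v + ->]].
    rewrite !inE => /andP[/andP[Gu1 Gu2] /eqP uE].
    exists (u.1 ^ z^-1, u.2 ^ z^-1)%g; last by rewrite /J /= !conjgKV -surjective_pairing.
    rewrite !inE /= !groupJ ?groupV // /comm_map -conjRg /= -/(comm_map u).
    by rewrite uE conjgK /=.
  rewrite !inE => /andP[/andP[Gv1 Gv2] /eqP <-].
  by rewrite /= !groupJ // /comm_map /= conjRg /=.
rewrite /comm_count (_ : [set _ in _ | _] = set0) ?cards0 //.
apply/setP=> u; rewrite !inE; apply: contraNF notGg => /andP[/andP[Gu1 Gu2] /eqP<-].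
by rewrite groupR.
Qed.

Definition comm_cfun (gT : finGroupType) (G : {group gT}) : 'CF(G) :=
  Cfun 0 (comm_count_class_fun G).

Lemma cfdot_comm_irr (gT : finGroupType) (G : {group gT}) (i : Iirr G) :
  '[comm_cfun G, 'chi_i] = #|G|%:R / 'chi_i 1%g.
Proof.
have chi1R : ('chi_i 1%g)^* = 'chi_i 1%g by rewrite irr1_degree conjC_nat.
(* The inner product conjugates its second argument. Swapping the arguments under an outer
   conjugation puts the conjugate on the counts, which are real. *)
rewrite -[LHS]conjCK -cfdotC cfdotE.
rewrite (eq_bigr (fun g => (comm_count G g)%:R * 'chi_i g)); last first.
  by move=> g _; rewrite cfunE conjC_nat mulrC.
rewrite sum_comm_count.
transitivity ((#|G|%:R^-1 * (\sum_(x in G) \sum_(y in G) 'chi_i (x^-1 * x ^ y)%g))^*).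
  congr ((_ * _)^*); rewrite pair_big /=; apply: eq_big => [[x y]|[x y] _] /=.
    rewrite !inE /=; apply: andb_idr => /andP[Gx Gy]; exact: groupR.
  by rewrite /comm_map /= commgEl.
(* Since [[~ x, y]] is [x^-1 * x ^ y], the sum over [y] is the Schur average at [x^-1] and [x]; the
   remaining sum over [x] is the norm of ['chi_i], namely 1. *)
rewrite (eq_bigr (fun x => #|G|%:R / 'chi_i 1%g * ('chi_i x * ('chi_i x)^*))); last first.
  move=> x Gx; rewrite sum_irr_mul_conj ?groupV // irr_inv.
  by rewrite [RHS]mulrAC -[_ * _ * 'chi_i x]mulrA [_^* * _]mulrC.
rewrite -mulr_sumr mulrCA -cfdotE cfdot_irr eqxx mulr1 rmorphM fmorphV /=.
by rewrite conjC_nat chi1R.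
Qed.

Lemma sum_sqr_comm_count_algC (gT : finGroupType) (G : {group gT}) :
  \sum_(g in G) ((comm_count G g)%:R - #|G|%:R) ^+ 2
    = #|G|%:R ^+ 3 * \sum_(i : Iirr G | i != 0) (irr_deg i)%:R ^- 2 :> algC.
Proof.
have G_neq0 : #|G|%:R != 0 :> algC by rewrite pnatr_eq0 -lt0n cardG_gt0.
(* On [G] the values of [phi] are the deviations. The subtraction kills exactly the trivial
   coordinate, equal to [#|G|] because the trivial character has degree 1. *)
pose phi := comm_cfun G - #|G|%:R *: 'chi_0.
have phiE i : '[phi, 'chi_i] = if i == 0 then 0 else #|G|%:R / (irr_deg i)%:R.
  rewrite cfdotBl cfdotZl cfdot_comm_irr cfdot_irr irr_degE eq_sym.
  by case: eqP => [->|_]; rewrite ?mulr0 ?subr0 // irr0 cfun11 invr1 subrr.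
have sumE : \sum_(g in G) ((comm_count G g)%:R - #|G|%:R) ^+ 2
            = #|G|%:R * '[phi] :> algC.
  rewrite cfdotE mulVKf //; apply: eq_bigr => g Gg.
  by rewrite !cfunE irr0 cfun1E Gg mulr1 rmorphB /= !conjC_nat expr2.
rewrite sumE cfdot_sum_irr (bigID (fun i => i == 0)) /= big1 => [|i /eqP->].
  rewrite add0r exprS -mulrA; congr (_ * _); rewrite mulr_sumr.
  apply: eq_bigr => i /negbTE i0; rewrite phiE i0 rmorphM fmorphV /=.
  by rewrite !conjC_nat mulrACA -!expr2 exprVn.
by rewrite phiE eqxx mul0r.
Qed.

(* Both sides are rational, so the identity moves from algC through rat to F. *)
Lemma sum_sqr_comm_count (F : numFieldType) (gT : finGroupType) (G : {group gT}) :
  \sum_(g in G) ((comm_count G g)%:R - #|G|%:R) ^+ 2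
    = #|G|%:R ^+ 3 * \sum_(i : Iirr G | i != 0) (irr_deg i)%:R ^- 2 :> F.
Proof.
pose lhs : rat := \sum_(g in G) ((comm_count G g)%:R - #|G|%:R) ^+ 2.
pose rhs : rat := #|G|%:R ^+ 3 * \sum_(i : Iirr G | i != 0) (irr_deg i)%:R ^- 2.
have lhsE (K : numFieldType) : ratr lhs
    = \sum_(g in G) ((comm_count G g)%:R - #|G|%:R) ^+ 2 :> K.
  rewrite rmorph_sum; apply: eq_bigr => g _.
  by rewrite rmorphXn rmorphB /= !ratr_nat.
have rhsE (K : numFieldType) : ratr rhs
    = #|G|%:R ^+ 3 * \sum_(i : Iirr G | i != 0) (irr_deg i)%:R ^- 2 :> K.
  rewrite rmorphM rmorphXn rmorph_sum /= ratr_nat; congr (_ * _).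
  by apply: eq_bigr => i _; rewrite fmorphV rmorphXn /= ratr_nat.
rewrite -lhsE -rhsE; congr ratr; apply: (fmorph_inj (@ratr algC)).
by rewrite /= lhsE rhsE sum_sqr_comm_count_algC.
Qed.

(** Cauchy-Schwarz against the constant 1, obtained from the nonnegative sum of squares of the
    scaled deviations [#|A| * f i - s] from the mean. *)
Lemma sqr_sum_le_card (F : realFieldType) (I : finType) (A : {set I}) (f : I -> F) :
  (\sum_(i in A) f i) ^+ 2 <= #|A|%:R * \sum_(i in A) f i ^+ 2.
Proof.
have [->|A_neq0] := eqVneq A set0; first by rewrite !big_set0 expr0n mulr0.
have A_gt0 : 0 < #|A|%:R :> F by rewrite ltr0n card_gt0.
set s := \sum_(i in A) f i; set q := \sum_(i in A) _ ^+ 2.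
have : 0 <= \sum_(i in A) (#|A|%:R * f i - s) ^+ 2.
  by apply: sumr_ge0 => i _; exact: sqr_ge0.
have -> : \sum_(i in A) (#|A|%:R * f i - s) ^+ 2 = #|A|%:R * (#|A|%:R * q - s ^+ 2).
  rewrite (eq_bigr (fun i =>
    #|A|%:R ^+ 2 * f i ^+ 2 - #|A|%:R * s *+ 2 * f i + s ^+ 2)) => [|i _]; last by ring.
  rewrite big_split sumrB /= -!mulr_sumr sumr_const -mulr_natl -/s -/q.
  by ring.
by rewrite pmulr_rge0 // subr_ge0.
Qed.

Lemma zeta2_subr1 (R : realType) (gT : finGroupType) (G : {group gT}) :
  zeta G 2 - 1 = \sum_(i : Iirr G | i != 0) (irr_deg i)%:R ^- 2 :> R.
Proof.
rewrite /zeta (bigD1 0) //=.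
have -> : irr_deg (0 : Iirr G) = 1%N.
  by apply/eqP; rewrite -(eqr_nat algC) irr_degE irr0 cfun11.
rewrite powR1 addrAC subrr add0r; apply: eq_bigr => i _.
by rewrite powRN powR_mulrn.
Qed.

Lemma epsilon_pow4 (R : realType) (gT : finGroupType) (G : {group gT}) :
  epsilon R G ^+ 4 = zeta G 2 - 1.
Proof.
(* The fourth power undoes the real power 1/4 only on a nonnegative base. *)
have ge0 : 0 <= zeta G 2 - 1 :> R.
  by rewrite zeta2_subr1 sumr_ge0 // => i _; rewrite invr_ge0 exprn_ge0.
by rewrite -powR_mulrn ?powR_ge0 // -powRrM mulVf ?powRr1 // pnatr_eq0.
Qed.

Lemma comm_preim_deviation (R : realType) (gT : finGroupType) (G : {group gT})
    (Y : {set gT}) : Y \subset G ->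
  `| #|[set u in setX G G | comm_map u \in Y]|%:R / #|G|%:R ^+ 2
     - #|Y|%:R / #|G|%:R | <= epsilon R G.
Proof.
move=> sYG; set P := [set u in _ | _]; set D := _ - _.
have G_gt0 : 0 < #|G|%:R :> R by rewrite ltr0n cardG_gt0.
(* [D] is a difference of two proportions, each between 0 and 1. *)
have D_le1 : `|D| <= 1.
  have p01 : 0 <= (#|P|%:R / #|G|%:R ^+ 2 : R) <= 1.
    rewrite divr_ge0 ?exprn_ge0 // ler_pdivrMr ?exprn_gt0 // mul1r -natrX ler_nat.
    rewrite expnS expn1 -cardsX subset_leq_card //.
    by apply/subsetP=> u; rewrite inE => /andP[].
  have q01 : 0 <= (#|Y|%:R / #|G|%:R : R) <= 1.
    by rewrite divr_ge0 // ler_pdivrMr // mul1r ler_nat subset_leq_card.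
  move: p01 q01 => /andP[p0 p1] /andP[q0 q1].
  by rewrite ler_norml /D; apply/andP; split; lra.
have D2_le : D ^+ 2 <= epsilon R G ^+ 4.
  have DE : #|G|%:R ^+ 2 * D = \sum_(g in Y) ((comm_count G g)%:R - #|G|%:R).
    rewrite sumrB sumr_const; under eq_bigr do rewrite -[_%:R]mulr1.
    rewrite (@sum_comm_count _ _ _ _ (fun=> 1)) sumr_const mulrBr; congr (_ - _).
      rewrite mulrC divfK ?expf_neq0 ?gt_eqF //; congr _%:R.
      by apply: eq_card => u; rewrite [LHS]inE.
    by rewrite -[RHS]mulr_natl mulrCA expr2 mulfK ?gt_eqF.
  have := sqr_sum_le_card Y (fun g => (comm_count G g)%:R - #|G|%:R : R).
  rewrite -DE => /le_trans le.
  (* One factor [#|G|] bounds [#|Y|]; the other three come from the sum of squares, enlarged from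
     [Y] to [G]. *)
  have {le} : (#|G|%:R ^+ 2 * D) ^+ 2 <= #|G|%:R ^+ 4 * epsilon R G ^+ 4.
    apply: le; rewrite exprS -mulrA epsilon_pow4 zeta2_subr1 -sum_sqr_comm_count.
    rewrite ler_pM ?ler_nat ?subset_leq_card ?sumr_ge0 // => [g _|].
      exact: sqr_ge0.
    rewrite [leRHS](big_setID Y) /= (setIidPr sYG) lerDl sumr_ge0 // => g _.
    exact: sqr_ge0.
  by rewrite exprMn -exprM ler_pM2l // exprn_gt0.
(* Fourth powers are compared, so that [D_le1] can absorb the gap between exponents 4 and 2. *)
rewrite -(@ler_pXn2r _ 4) ?nnegrE ?powR_ge0 //; apply: le_trans D2_le.
by rewrite -[D ^+ 2]real_normK ?num_real // ler_wiXn2l.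
Qed.

Theorem corollary1p4 (R : realType) (gT : finGroupType) (G : {group gT}) :
  (forall Y : {set gT}, Y \subset G ->
     `| #|[set u in setX G G | comm_map u \in Y]|%:R / #|G|%:R ^+ 2
        - #|Y|%:R / #|G|%:R | <= 3 * epsilon R G)
  /\
  (forall X : {set gT * gT}, X \subset setX G G ->
     #|[set comm_map u | u in X]|%:R / #|G|%:R
       >= #|X|%:R / #|G|%:R ^+ 2 - 3 * epsilon R G).
Proof.
have eps_ge0 : 0 <= epsilon R G by exact: powR_ge0.
have bound (Y : {set gT}) : Y \subset G ->
  `| #|[set u in setX G G | comm_map u \in Y]|%:R / #|G|%:R ^+ 2
     - #|Y|%:R / #|G|%:R | <= 3 * epsilon R G.
  move=> sYG; apply: le_trans (comm_preim_deviation R sYG) _.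
  by rewrite ler_peMl // ler1n.
split=> // X sXG; set Y := [set comm_map u | u in X].
have sYG : Y \subset G.
  apply/subsetP=> _ /imsetP[u /(subsetP sXG) + ->].
  by rewrite inE => /andP[Gu1 Gu2]; exact: groupR.
have XleP : #|X|%:R / #|G|%:R ^+ 2
    <= #|[set u in setX G G | comm_map u \in Y]|%:R / #|G|%:R ^+ 2 :> R.
  rewrite ler_wpM2r ?invr_ge0 ?exprn_ge0 // ler_nat subset_leq_card //.
  by apply/subsetP=> u Xu; rewrite inE (subsetP sXG) ?imset_f.
by have := bound Y sYG; rewrite ler_norml => /andP[_]; lra.
Qed.
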